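(* Assume that there exists $w^{*}\in\mathbb{R}^{d}$ such that $Y=\langle w^{*},X\rangle$ (almost surely). Let $\rho:=\sup_{w\in\mathbb{R}^d\setminus\{0\}}\mathrm{P}(\langle w,X\rangle=0)$ (one has $\rho<1$). Then for all $n\ge d$ and all $p\in(1,\infty)$, $$\mathrm{P}\left(\hat w_p\neq w^{*}\right)\le \binom{n}{d-1}\rho^{\,n-d+1}.$$ Furthermore, there is an absolute constant $C>0$ (independent of $d$, $n$, $p$, $\delta$ and the distribution of $(X,Y)$) such that for every $\delta\in(0,1]$, if $$n\ge\begin{cases} C\left(d+\dfrac{\log(1/\delta)}{\log(1/\rho)}\right) & \text{if } 0\le\rho<e^{-1},\\[2mm] C\,\dfrac{d+\log(1/\delta)}{1-\rho} & \text{if } e^{-1}\le\rho<e^{-1/e},\\[2mm] C\,\dfrac{d\log(1/(1-\rho))+\log(1/\delta)}{1-\rho} & \text{if } e^{-1/e}\le\rho<1,\end{cases}$$ then for all $p\in(1,\infty)$, with probability at least $1-\delta$, $\hat w_p=w^{*}$. (When $\rho=0$, the quotient $\log(1/\delta)/\log(1/\rho)$ is read as $0$.)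
   Context: $X$ is a random vector in $\mathbb{R}^d$ and $Y$ a real random variable; $(X_i,Y_i)_{i=1}^n$ are i.i.d. copies of $(X,Y)$. Standing assumption: the support of $X$ is not contained in any hyperplane, i.e. $\mathrm{P}(\langle w,X\rangle=0)=1$ only if $w=0$. No moment assumptions are made. For $p\in(1,\infty)$, $\ell_p(t):=|t|^p/[p(p-1)]$, the empirical risk is $R_{p,n}(w):=\frac1n\sum_{i=1}^n\ell_p(\langle w,X_i\rangle-Y_i)$, and $\hat w_p\in\arg\min_{w\in\mathbb{R}^d}R_{p,n}(w)$ denotes any empirical risk minimizer. *)

(* Defs.v *)
From mathcomp Require Export all_boot all_order all_algebra.
From mathcomp Require Export all_classical all_reals all_analysis.
Export Order.TTheory GRing.Theory Num.Theory.

Set Implicit Arguments.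
Unset Strict Implicit.
Unset Printing Implicit Defensive.

Local Open Scope classical_set_scope.
Local Open Scope ring_scope.

(* Covariates live in [d.-tuple R], which the library equips with the product
   (that is, Borel) sigma-algebra of R^d; weights live in ['rV[R]_d], which has
   the vector space structure. *)
Definition dotv (R : realType) (d : nat) (w : 'rV[R]_d) (x : d.-tuple R) : R :=
  \sum_(j < d) w ord0 j * tnth x j.

Section Independence.
Context {disp disp' : measure_display} {T : measurableType disp}
  {U : measurableType disp'} {R : realType}.

Definition mutually_independent (P : probability T R) (n : nat)
    (Z : 'I_n -> T -> U) : Prop :=
  forall (J : {set 'I_n}) (B : 'I_n -> set U),
    (forall i, measurable (B i)) ->
    (P (\bigcap_(i in [set` J]) (Z i @^-1` B i)) =
     \prod_(i in J) P (Z i @^-1` B i))%E.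

Definition iid_copies (P : probability T R) (n : nat)
    (Z0 : T -> U) (Z : 'I_n -> T -> U) : Prop :=
  (forall (i : 'I_n) (B : set U), measurable B ->
     P (Z i @^-1` B) = P (Z0 @^-1` B)) /\
  mutually_independent P Z.

End Independence.

Section Regression.
Context {R : realType}.

Definition ell (p t : R) : R := `|t| `^ p / (p * (p - 1)).

Definition empirical_risk (d n : nat) (p : R)
    (x : 'I_n -> d.-tuple R) (y : 'I_n -> R) (w : 'rV[R]_d) : R :=
  n%:R^-1 * \sum_(i < n) ell p (dotv w (x i) - y i).

Definition is_erm (d n : nat) (p : R)
    (x : 'I_n -> d.-tuple R) (y : 'I_n -> R) (w : 'rV[R]_d) : Prop :=
  forall v : 'rV[R]_d, empirical_risk p x y w <= empirical_risk p x y v.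

Definition nondegenerate {disp : measure_display} {T : measurableType disp}
    (P : probability T R) (d : nat) (X : T -> d.-tuple R) : Prop :=
  forall w : 'rV[R]_d, P [set t | dotv w (X t) = 0] = 1%E -> w = 0.

(* For [0 < d] this is the supremum of a nonempty subset of [0, 1]; for
   [d = 0] the set is empty and [sup] returns a default value. *)
Definition rho {disp : measure_display} {T : measurableType disp}
    (P : probability T R) (d : nat) (X : T -> d.-tuple R) : R :=
  sup [set fine (P [set t | dotv w (X t) = 0])
      | w in [set w : 'rV[R]_d | w != 0]].

Definition sample_size (C : R) (d : nat) (r delta : R) : R :=
  if r < expR (- 1) then
    C * (d%:R + (if r == 0 then 0 else ln (1 / delta) / ln (1 / r)))
  else if r < expR (- expR (- 1)) then
    C * ((d%:R + ln (1 / delta)) / (1 - r))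
  else
    C * ((d%:R * ln (1 / (1 - r)) + ln (1 / delta)) / (1 - r)).

End Regression.

(* Main.v *)
From HB Require Import structures.
Require Import Defs.
From mathcomp Require Import lra ring measurable_realfun.

Set Implicit Arguments.
Unset Strict Implicit.
Unset Printing Implicit Defensive.

Local Open Scope classical_set_scope.
Local Open Scope ring_scope.

(** Almost surely the data are fitted exactly by [wstar], so the minimal empirical
    risk is [0] and every minimizer fits the data exactly ([erm_interpolates]).
    Hence a minimizer other than [wstar] exists only if some nonzero vector is
    orthogonal to all the covariates, i.e. if they do not span [R^d]. In that case
    [d.-1] of them already span all of them ([few_span]). For a fixed set [S] of
    [d.-1] indices, condition on the covariates in [S]: their span lies in a
    hyperplane, so each of the [n - d + 1] other covariates falls into it with
    probability at most [rho], independently of one another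
    ([spanned_by_event_le]). A union bound over the ['C(n, d.-1)] choices of [S]
    gives the first inequality ([prob_erm_neq_le]).

    The conditioning is done by Fubini's theorem, one covariate at a time. This
    needs that a covariate is independent of the tuple of all the others, which
    follows from the product rule on boxes by Dynkin's theorem
    ([indep_replace_entry]), and that belonging to a span is a measurable condition,
    which follows from approximation by rational combinations
    ([spanned_by_approx]).

    That [rho < 1] is not a consequence of each hyperplane having mass below [1],
    since a supremum need not be attained. Instead of compactness of the sphere,
    the proof uses that a decreasing family of subspaces is eventually constant
    ([rho_lt1]).

    The sample size bound is calculus: writing [a] for [1 - rho] (or for [1] when
    [rho < 1/e]), the inequality ['C(n, k) * (a / 4) ^+ k <= expR (n * a / 4)] makes
    the binomial coefficient cost only a fraction of the exponential gain
    [n * ln (1 / rho)] ([sample_size_suffices]). *)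

(** * Sample size *)

(** The left-hand side is one term of the expansion of [(1 + x) ^+ n]. *)
Lemma binomial_term_le_expR (R : realType) (n k : nat) (x : R) :
  0 <= x -> 'C(n, k)%:R * x ^+ k <= expR (n%:R * x).
Proof.
move=> x0; apply: (@le_trans _ _ ((1 + x) ^+ n)); last first.
  by rewrite expRM_natl lerXn2r ?nnegrE ?expR_ge0 ?addr_ge0// expR_ge1Dx.
have [kn|nk] := leqP k n; last by rewrite bin_small// mul0r exprn_ge0// addr_ge0.
rewrite exprDn (bigD1 (Ordinal (ltnSE kn : k < n.+1)%N))//= expr1n mul1r mulr_natl.
rewrite lerDl sumr_ge0// => i _.
by rewrite expr1n mul1r mulrn_wge0// exprn_ge0.
Qed.

(** The arithmetic shared by the three regimes of the sample size, with a free
    parameter [a] in place of [1 - r]. Bounding [(a / 4) ^+ d.-1 * 'C(n, d.-1)] by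
    [expR (n * a / 4)] shows that the logarithm of the left-hand side is at most
    [d * ln (4 / a) + n * a / 4 - (n - d) * L] with [L = ln (1 / r)]. The hypotheses
    make the three terms at most [0.4 n L], [0.25 n L] and [- 0.9 n L], so the sum is
    at most [- 0.25 n L], and [0.25 n L >= 2.5 ln (1 / delta)]. *)
Lemma binomial_tail_le (R : realType) (n d : nat) (r a delta : R) :
  0 < r -> 0 < delta -> 0 < a -> a <= 4 ->
  a <= ln (1 / r) ->
  10 * d%:R <= n%:R :> R ->
  10 * (d%:R * ln (4 / a)) <= 4 * (n%:R * ln (1 / r)) ->
  10 * ln (1 / delta) <= n%:R * ln (1 / r) ->
  0 <= ln (1 / delta) :> R ->
  'C(n, d.-1)%:R * r ^+ (n - d).+1 <= delta.
Proof.
move=> r0 del0 a0 a4; set L := ln (1 / r) => aL dn dK nL ld0.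
have rE : r = expR (- L) by rewrite /L div1r lnV// opprK lnK.
have dE : delta = expR (- ln (1 / delta)) by rewrite div1r lnV// opprK lnK.
have q1 : 1 <= 4 / a by rewrite ler_pdivlMr// mul1r.
have q0 : 0 < 4 / a by rewrite divr_gt0.
have lq0 : 0 <= ln (4 / a) by rewrite ln_ge0.
have bin_le : 'C(n, d.-1)%:R <= expR (n%:R * (a / 4) + d%:R * ln (4 / a)).
  have := @binomial_term_le_expR R n d.-1 (a / 4) (ltW (divr_gt0 a0 (ltr0Sn _ 3))).
  rewrite -ler_pdivlMr ?exprn_gt0 ?divr_gt0// => /le_trans; apply.
  rewrite expRD ler_wpM2l ?expR_ge0// -exprVn invf_div.
  rewrite -[X in X ^+ _ <= _](@lnK _ (4 / a)) ?posrE// -expRM_natl ler_expR.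
  by rewrite ler_wpM2r// ler_nat leq_pred.
have dn' : (d <= n)%N.
  by rewrite -(ler_nat R); apply: le_trans dn; rewrite ler_peMl// ler1n.
rewrite [X in _ * X ^+ _]rE -expRM_natl -natr1 natrB//.
apply: (le_trans (ler_wpM2r (expR_ge0 _) bin_le)).
rewrite -expRD [leRHS]dE ler_expR.
have aLn : n%:R * a <= n%:R * L by rewrite ler_wpM2l.
have L0 : 0 <= L by apply: le_trans aL; exact: ltW.
have dLn : 10 * d%:R * L <= n%:R * L by rewrite ler_wpM2r.
lra.
Qed.

Lemma le_ln_inv (R : realType) (r : R) : 0 < r -> 1 - r <= ln (1 / r).
Proof.
move=> r0; rewrite div1r lnV//; have := @le_ln1Dx R (r - 1).
have -> : 1 + (r - 1) = r by ring.
have m1 : -1 < r - 1 by lra.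
by move=> /(_ m1); lra.
Qed.

Lemma ln4_le2 (R : realType) : ln 4 <= 2 :> R.
Proof.
rewrite -ler_expR lnK ?posrE//; have := @expR_ge1Dx R 1.
move=> h; have -> : 2 = 2%:R * 1 :> R by rewrite mulr1.
rewrite expRM_natl.
by apply: le_trans (lerXn2r 2 _ _ h); rewrite ?nnegrE ?expR_ge0 ?expr2; lra.
Qed.

Lemma expRN1_ge (R : realType) : 4^-1 <= expR (- 1) :> R.
Proof.
have := @expR_ge1Dx R (- 2^-1); have -> : - 1 = 2%:R * - 2^-1 :> R by lra.
rewrite expRM_natl => h; apply: le_trans (lerXn2r 2 _ _ h); rewrite ?nnegrE ?expR_ge0 ?expr2; lra.
Qed.

(** In the middle regime [1 - r] is bounded away from [0], so that the
    [ln (1 / (1 - r))] of the last regime is absorbed by a constant. *)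
Lemma ln_mid_le (R : realType) (r : R) :
  r < expR (- expR (- 1)) -> ln (4 / (1 - r)) <= 4.
Proof.
move=> rlt.
(* e^(-1/e) <= 1 / (1 + 1/e) <= 4/5, so 4 / (1 - r) <= 20 <= (9/4)^4 <= e^4 *)
have e45 : expR (- expR (- 1)) <= 4 / 5 :> R.
  rewrite expRN; have -> : 4 / 5 = (5 / 4)^-1 :> R by lra.
  rewrite lef_pV2 ?posrE ?expR_gt0//.
  by apply: le_trans (expR_ge1Dx _); have := @expRN1_ge R; lra.
have : 9 / 4 <= expR 1 :> R.
  have := @expR_ge1Dx R (2^-1); have -> : expR 1 = expR (2%:R * 2^-1) :> R by congr expR; lra.
  rewrite expRM_natl => h; apply: le_trans (lerXn2r 2 _ _ h);
    rewrite ?nnegrE ?expR_ge0 ?expr2; lra.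
move=> h; have := lerXn2r 4 _ _ h; rewrite ?nnegrE ?expR_ge0 => h4.
rewrite -ler_expR lnK ?posrE; last by rewrite divr_gt0//; lra.
have -> : 4 = 4%:R * 1 :> R by rewrite mulr1.
rewrite expRM_natl mulr1; apply: le_trans (h4 _ isT); last by lra.
rewrite ler_pdivrMr; last by lra.
by rewrite !exprS expr0; lra.
Qed.

(** The constant [10] of the theorem comes from here. For [r < 1/e] one takes
    [a = 1 <= ln (1 / r)]; in the other two regimes [a = 1 - r]. *)
Lemma sample_size_suffices (R : realType) (n d : nat) (r delta : R) :
  (0 < d)%N -> 0 <= r -> r < 1 -> 0 < delta -> delta <= 1 ->
  sample_size 10 d r delta <= n%:R ->
  (d <= n)%N /\ 'C(n, d.-1)%:R * r ^+ (n - d).+1 <= delta.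
Proof.
move=> d0 r0 r1 del0 del1 H.
have ld0 : 0 <= ln (1 / delta) by rewrite ln_ge0// ler_pdivlMr// mul1r.
have [d0' n0] : 0 <= d%:R :> R /\ 0 <= n%:R :> R by [].
move: r0; rewrite le_eqVlt => /predU1P[r0|r0].
  move: H; rewrite -r0 /sample_size expR_gt0 eqxx addr0 => H.
  split; last by rewrite expr0n/= mulr0 ltW.
  by rewrite -(ler_nat R); lra.
have Lge := @le_ln_inv R r r0.
have a0 : 0 < 1 - r by lra.
suff [a [h1 h2 h3 [h4 h5] h6]] : exists a : R, [/\ 0 < a, a <= 4, a <= ln (1 / r),
    10 * d%:R <= n%:R :> R /\ 10 * (d%:R * ln (4 / a)) <= 4 * (n%:R * ln (1 / r)) &
    10 * ln (1 / delta) <= n%:R * ln (1 / r)].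
  split; last exact: (@binomial_tail_le R n d r a delta).
  by rewrite -(ler_nat R); lra.
have nLge : n%:R * (1 - r) <= n%:R * ln (1 / r) by rewrite ler_wpM2l.
have na_le : n%:R * (1 - r) <= n%:R by rewrite ler_piMr//; lra.
move: H; rewrite /sample_size; case: ifPn => [re|re].
  rewrite gt_eqF// => H; exists 1.
  have L1 : 1 <= ln (1 / r) by rewrite div1r lnV// lerNr -ler_expR lnK// ltW.
  have q0 : 0 <= ln (1 / delta) / ln (1 / r) by rewrite divr_ge0//; lra.
  have nL : n%:R <= n%:R * ln (1 / r) by apply: ler_peMr.
  have d2 : d%:R * ln 4 <= d%:R * 2 :> R by apply: ler_wpM2l => //; exact: ln4_le2.
  split=> //; [lra | rewrite divr1; lra |].
  have : 10 * (ln (1 / delta) / ln (1 / r)) <= n%:R by lra.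
  by rewrite mulrA ler_pdivrMr//; lra.
case: ifPn => [rm|rm].
  rewrite mulrA ler_pdivrMr// => H; exists (1 - r).
  have d4 : d%:R * ln (4 / (1 - r)) <= d%:R * 4 by apply: ler_wpM2l => //; exact: ln_mid_le.
  by split=> //; lra.
rewrite mulrA ler_pdivrMr// => H; exists (1 - r).
(* here 1 - r <= 1 - e^(-1/e) <= 1/e *)
have l1 : 1 <= ln (1 / (1 - r)).
  rewrite div1r lnV// lerNr -ler_expR lnK//.
  by have := @expR_ge1Dx R (- expR (- 1)); move: rm; rewrite -leNgt; lra.
have dl : d%:R <= d%:R * ln (1 / (1 - r)) by apply: ler_peMr.
have lnE : ln (4 / (1 - r)) = ln 4 + ln (1 / (1 - r)).
  by rewrite -lnM ?posrE ?mulrA ?mulr1// divr_gt0.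
have d3 : d%:R * ln (4 / (1 - r)) <= d%:R * (3 * ln (1 / (1 - r))).
  by apply: ler_wpM2l => //; rewrite lnE; have := @ln4_le2 R; lra.
by split=> //; lra.
Qed.

(** * Exact fit and spans of covariates *)

(** The risk is nonnegative and vanishes at [wstar], so every minimizer has zero
    risk; since [ell p] vanishes only at [0], a minimizer fits the data exactly. *)
Lemma erm_interpolates (R : realType) (d n : nat) (p : R)
    (x : 'I_n -> d.-tuple R) (y : 'I_n -> R) (wstar w : 'rV[R]_d) :
  1 < p -> (forall i, y i = dotv wstar (x i)) -> is_erm p x y w ->
  forall i, dotv w (x i) = y i.
Proof.
move=> p1 yE erm i.
have ell_ge0 t : 0 <= ell p t.
  by rewrite /ell divr_ge0 ?powR_ge0// mulr_ge0; lra.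
have n0 : (0 < n)%N by case: n i {x y yE erm} => [[]|].
have risk0 : empirical_risk p x y wstar = 0.
  rewrite /empirical_risk big1 ?mulr0// => j _.
  by rewrite yE subrr /ell normr0 powR0 ?mul0r//; lra.
have := erm wstar; rewrite risk0 /empirical_risk pmulr_rle0 ?invr_gt0 ?ltr0n// => h.
have /eqP : \sum_(j < n) ell p (dotv w (x j) - y j) = 0.
  by apply/eqP; rewrite eq_le h sumr_ge0.
move=> /eqP/psumr_eq0P => /(_ (fun j _ => ell_ge0 _) i isT)/eqP.
rewrite /ell mulf_eq0 invr_eq0 mulf_eq0 powR_eq0 normr_eq0.
by rewrite subr_eq0 => /orP[/andP[/eqP->//]|/orP[]/eqP]; lra.
Qed.

Lemma subset_of_card (I : finType) (A : {set I}) (k : nat) :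
  (#|A| <= k)%N -> (k <= #|I|)%N -> exists2 B : {set I}, A \subset B & #|B| = k.
Proof.
elim: k => [|k IH] Ak kI; first by exists A; last by apply/eqP; rewrite -leqn0.
move: Ak; rewrite leq_eqVlt => /predU1P[Ak|Ak]; first by exists A.
have [B AB Bk] := IH Ak (ltnW kI).
have : (0 < #|~: B|)%N by move: kI; rewrite -(cardsC B) Bk -[X in (X < _)%N]addn0 ltn_add2l.
move=> /card_gt0P[i]; rewrite inE => iB.
exists (i |: B); last by rewrite cardsU1 iB Bk.
exact: fintype.subset_trans AB (finset.subsetUr _ _).
Qed.

Section Span.
Context (R : realType) (n d : nat).
Implicit Types (x : n.-tuple (d.-tuple R)) (z : d.-tuple R) (S : {set 'I_n}).

Definition row_of_tuple z : 'rV[R]_d := \row_j tnth z j.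

(** Membership of [z] in the linear span of the entries of [x] with index in [S].
    The row spaces are summed as square matrices, hence the [<<_>>]. *)
Definition spanned_by S x z : bool :=
  (row_of_tuple z <= \sum_(i in S) <<row_of_tuple (tnth x i)>>)%MS.

Lemma dotvE (w : 'rV[R]_d) z : dotv w z = (row_of_tuple z *m w^T) ord0 ord0.
Proof. by rewrite mxE; apply: eq_bigr => j _; rewrite !mxE mulrC. Qed.

Lemma spanned_byP S x z :
  reflect (exists c : 'I_n -> R,
             forall j, tnth z j = \sum_(i in S) c i * tnth (tnth x i) j)
          (spanned_by S x z).
Proof.
apply: (iffP idP) => [/sub_sumsmxP[u uE]|[c cE]].
  have /all_sig[c cE] : forall i, {c | u i *m <<row_of_tuple (tnth x i)>>%MS
      = c *: row_of_tuple (tnth x i)}.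
    move=> i; apply: cid.
    have /submxP[D ->] : (u i *m <<row_of_tuple (tnth x i)>>%MS
        <= row_of_tuple (tnth x i))%MS by rewrite -(genmxE (row_of_tuple _)) submxMl.
    by exists (D ord0 ord0); rewrite [in LHS](mx11_scalar D) mul_scalar_mx.
  exists c => j; have -> : tnth z j = row_of_tuple z ord0 j by rewrite mxE.
  rewrite uE summxE; apply: eq_bigr => i _.
  by rewrite cE !mxE.
rewrite /spanned_by; have -> : row_of_tuple z = \sum_(i in S) c i *: row_of_tuple (tnth x i).
  by apply/rowP => j; rewrite mxE cE summxE; apply: eq_bigr => i _; rewrite !mxE.
apply: summx_sub_sums => i _.
by rewrite genmxE scalemx_sub.
Qed.

Lemma spanned_by_ext S x x' z :
  (forall i, i \in S -> tnth x i = tnth x' i) ->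
  spanned_by S x z = spanned_by S x' z.
Proof.
by move=> xx'; rewrite /spanned_by; congr (_ <= _)%MS; apply: eq_bigr => i /xx'->.
Qed.

Lemma row_in_genmx S x i : i \in S ->
  (row_of_tuple (tnth x i) <= \sum_(i in S) <<row_of_tuple (tnth x i)>>)%MS.
Proof. by move=> iS; rewrite (sumsmx_sup i)// genmxE. Qed.

(** The columns of [cokermx] are the linear forms that cut out the row space. *)
Lemma not_spanned_by_separated S x z : ~~ spanned_by S x z ->
  exists2 w : 'rV[R]_d, forall i, i \in S -> dotv w (tnth x i) = 0 & dotv w z != 0.
Proof.
rewrite /spanned_by submxE; set M := (\sum_(i in S) _)%MS.
move=> /rV0Pn[j zj]; exists (\row_k cokermx M k j) => [i iS|].
  have : (row_of_tuple (tnth x i) *m cokermx M == 0).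
    by rewrite -submxE row_in_genmx.
  move=> /eqP/(congr1 (fun N : 'rV_d => N ord0 j)); rewrite !mxE => <-.
  by rewrite /dotv; apply: eq_bigr => k _; rewrite !mxE mulrC.
move: zj; rewrite mxE; congr (_ != _).
by rewrite /dotv; apply: eq_bigr => k _; rewrite !mxE mulrC.
Qed.

(** Fewer than [d] vectors do not span the whole space; this is how the bound
    [rho] on the mass of hyperplanes applies to spans of random vectors. *)
Lemma hyperplane_of_few S x : (#|S| < d)%N ->
  exists2 w : 'rV[R]_d, w != 0 & forall z, spanned_by S x z -> dotv w z = 0.
Proof.
move=> Sd; set M := (\sum_(i in S) <<row_of_tuple (tnth x i)>>)%MS.
have rM : (\rank M < d)%N.
  apply: leq_ltn_trans Sd; rewrite -sum1_card /M.
  elim/big_rec2: _ => [|i k A _ IH]; first by rewrite mxrank0.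
  apply: leq_trans (mxrank_adds_leqif _ _) _.
  by rewrite leq_add// mxrank_gen rank_leq_row.
have K0 : kermx M^T != 0 by rewrite -mxrank_eq0 mxrank_ker mxrank_tr -lt0n subn_gt0.
exists (nz_row (kermx M^T)); first by rewrite nz_row_eq0.
have Mw : M *m (nz_row (kermx M^T))^T = 0.
  by apply: trmx_inj; rewrite trmx_mul trmxK trmx0; exact/sub_kermxP/nz_row_sub.
by move=> z /submxP[D zE]; rewrite dotvE zE -mulmxA Mw mulmx0 mxE.
Qed.

(** The rows have rank at most [d.-1], so a maximal free subfamily has at most
    [d.-1] elements. It is then enlarged to a subfamily of size exactly [d.-1]: this
    uniform size is what makes the union bound cost only ['C(n, d.-1)]. *)
Lemma few_span x (w : 'rV[R]_d) : (d <= n)%N -> w != 0 ->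
  (forall i, dotv w (tnth x i) = 0) ->
  exists2 S : {set 'I_n}, #|S| = d.-1 & forall i, spanned_by S x (tnth x i).
Proof.
move=> dn w0 xw; pose M : 'M[R]_(n, d) := \matrix_(i < n) row_of_tuple (tnth x i).
have rowM i : row i M = row_of_tuple (tnth x i) by rewrite rowK.
have rM : (\rank M <= d.-1)%N.
  have wM : w *m M^T = 0.
    apply/rowP => i; rewrite !mxE -[RHS](xw i).
    by apply: eq_bigr => j _; rewrite !mxE.
  have /mxrankS : (w <= kermx M^T)%MS by apply/sub_kermxP.
  rewrite rank_rV w0 mxrank_ker mxrank_tr subn_gt0.
  by move=> h; rewrite -ltnS prednK// (leq_ltn_trans _ h).
have [|//|S fS Sd] := @subset_of_card _ [set maxrankfun M i | i in 'I_(\rank M)] d.-1.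
- by apply: leq_trans (leq_imset_card _ _) _; rewrite card_ord.
- by rewrite card_ord (leq_trans (leq_pred _)).
exists S => // i; rewrite /spanned_by -rowM.
apply: submx_trans (row_sub i M) _.
rewrite -(eq_maxrowsub M); apply/row_subP => k.
rewrite row_rowsub rowM row_in_genmx//.
by apply: (fintype.subsetP fS); rewrite imset_f.
Qed.

End Span.

(** * Measurability of spans *)

(** A subspace of [R^d] is closed, so belonging to a span is being arbitrarily
    close to rational combinations. The point of this form is that it involves only
    countable unions and intersections, which yields measurability. Closedness is
    obtained from a separating linear form: it is bounded by a multiple of the
    distance and vanishes on the span. *)
Lemma spanned_by_approx (R : realType) (n d : nat) (S : {set 'I_n})
    (x : n.-tuple (d.-tuple R)) (z : d.-tuple R) :
  spanned_by S x z <-> forall m : nat, exists q : {ffun 'I_n -> rat},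
    \sum_(j < d) `|tnth z j - \sum_(i in S) ratr (q i) * tnth (tnth x i) j|
      <= m.+1%:R^-1.
Proof.
split=> [/spanned_byP[c cE] m|approx].
  pose B := \sum_(j < d) \sum_(i in S) `|tnth (tnth x i) j|.
  have B0 : 0 <= B by apply: sumr_ge0 => j _; exact: sumr_ge0.
  (* rounding the coefficients to within [eta] moves the combination by at most
     [eta * B]; the [+ 1] guards against [B = 0] *)
  pose eta : R := m.+1%:R^-1 / (B + 1).
  have eta0 : 0 < eta by rewrite divr_gt0// ltr_wpDl.
  have /all_sig[q qE] i : {q : rat | `|c i - ratr q| <= eta}.
    apply: cid; have [|q] := @rat_in_itvoo R (c i) (c i + eta).
      by rewrite ltrDl.
    rewrite in_itv/= => /andP[cq qc]; exists q.
    by rewrite ltr0_norm ?subr_lt0// opprB lerBlDl ltW.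
  exists (finfun q); apply: (@le_trans _ _ (eta * B)); last first.
    rewrite /eta mulrAC ler_pdivrMr ?ltr_wpDl// ler_wpM2l ?lerDl//.
  rewrite /B mulr_sumr; apply: ler_sum => j _.
  rewrite cE -sumrB mulr_sumr; apply: le_trans (ler_norm_sum _ _ _) _.
  by apply: ler_sum => i _; rewrite ffunE -mulrBl normrM ler_wpM2r.
apply: contrapT => /negP /not_spanned_by_separated[w wS wz].
pose W := \sum_(j < d) `|w ord0 j|.
have W0 : 0 < W + 1 by rewrite ltr_wpDl// sumr_ge0.
have e0 : 0 < `|dotv w z| / (W + 1) by rewrite divr_gt0// normr_gt0.
have [m] := ltr_add_invr e0; rewrite add0r ltr_pdivlMr// ltNge => /negP; apply.
have [q qm] := approx m.
have -> : dotv w z = \sum_(j < d) w ord0 j *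
    (tnth z j - \sum_(i in S) ratr (q i) * tnth (tnth x i) j).
  have w0 : \sum_(j < d) w ord0 j *
      \sum_(i in S) ratr (q i) * tnth (tnth x i) j = 0.
    under eq_bigr => j _ do rewrite mulr_sumr.
    rewrite exchange_big big1//= => i iS.
    under eq_bigr => j _ do rewrite mulrCA.
    by rewrite -mulr_sumr -/(dotv _ _) wS// mulr0.
  rewrite -[LHS]subr0 -[X in _ - X]w0 /dotv -sumrB.
  by apply: eq_bigr => j _; rewrite mulrBr.
apply: (@le_trans _ _ (\sum_(j < d) (W + 1) *
    `|tnth z j - \sum_(i in S) ratr (q i) * tnth (tnth x i) j|)).
  apply: le_trans (ler_norm_sum _ _ _) _; apply: ler_sum => j _.
  rewrite normrM ler_wpM2r//; apply: (@le_trans _ _ W); last by rewrite lerDl.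
  by rewrite /W (bigD1 j)//= lerDl sumr_ge0.
by rewrite -mulr_sumr mulrC; apply: ler_wpM2r; [exact: ltW|exact: qm].
Qed.

Lemma measurable_tnth_comp (disp disp' : measure_display) (T : measurableType disp)
    (U : measurableType disp') (n : nat) (f : T -> n.-tuple U) (i : 'I_n) :
  measurable_fun setT f -> measurable_fun setT (fun t => tnth (f t) i).
Proof. by move=> /measurable_fun_tnthP mf; exact: mf. Qed.

Lemma measurable_spanned_by (R : realType) (n d : nat) (S : {set 'I_n})
    (disp : measure_display) (T : measurableType disp)
    (f : T -> n.-tuple (d.-tuple R)) (g : T -> d.-tuple R) :
  measurable_fun setT f -> measurable_fun setT g ->
  measurable [set t | spanned_by S (f t) (g t)].
Proof.
move=> mf mg.
pose D (q : {ffun 'I_n -> rat}) t :=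
  \sum_(j < d) `|tnth (g t) j - \sum_(i in S) ratr (q i) * tnth (tnth (f t) i) j|.
have -> : [set t | spanned_by S (f t) (g t)] =
    \bigcap_(m : nat) \bigcup_q [set t | D q t <= m.+1%:R^-1].
  apply/seteqP; split=> t /=.
    by move=> /spanned_by_approx h m _; have [q qm] := h m; exists q.
  by move=> h; apply/spanned_by_approx => m; have [q _ qm] := h m I; exists q.
apply: bigcapT_measurable => m; apply: countable_bigcupT_measurable => // q.
rewrite -[X in measurable X]setTI.
apply: measurable_fun_le => //; apply: measurable_sum => j.
apply: measurableT_comp => //; apply: measurable_funB.
  exact: measurable_tnth_comp.
rewrite (_ : (fun _ => _) = (fun t => \sum_(i <- enum S) ratr (q i) * tnth (tnth (f t) i) j)).
  apply: measurable_sum => i; apply: measurable_funM => //.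
  by do 2 apply: measurable_tnth_comp.
by apply/funext => t; rewrite big_enum.
Qed.

Lemma measurable_dotv (R : realType) (d : nat) (w : 'rV[R]_d)
    (disp : measure_display) (T : measurableType disp) (f : T -> d.-tuple R) :
  measurable_fun setT f -> measurable_fun setT (fun t => dotv w (f t)).
Proof.
move=> mf; apply: measurable_sum => j; apply: measurable_funM => //.
exact: measurable_tnth_comp.
Qed.

Lemma measurable_dotv_eq0 (R : realType) (d : nat) (w : 'rV[R]_d)
    (disp : measure_display) (T : measurableType disp) (f : T -> d.-tuple R) :
  measurable_fun setT f -> measurable [set t | dotv w (f t) = 0].
Proof.
move=> /(measurable_dotv w) mf.
by rewrite -[X in measurable X]setTI; exact: (mf measurableT [set 0]).
Qed.

(** * Independence and Fubini *)

(** By independence the law of [(V, Z)] is the product of the laws of [V] and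
    [Z], so the probability of [E] is the integral over [v] of the [Z]-probability of
    the section of [E] at [v]. *)
Lemma indep_section_le (disp d1 d2 : measure_display) (T : measurableType disp)
    (U1 : measurableType d1) (U2 : measurableType d2) (R : realType)
    (P : probability T R) (V : {mfun T >-> U1}) (Z : {mfun T >-> U2})
    (A : set U1) (E : set (U1 * U2)) (r : \bar R) :
  (forall B C, measurable B -> measurable C ->
     P (V @^-1` B `&` Z @^-1` C) = (P (V @^-1` B) * P (Z @^-1` C))%E) ->
  measurable A -> measurable E ->
  (forall v, A v -> (P (Z @^-1` xsection E v) <= r)%E) ->
  (P [set t | A (V t) /\ E (V t, Z t)] <= r * P (V @^-1` A))%E.
Proof.
move=> indep mA mE sect.
have mVZ : measurable_fun setT (fun t => (V t, Z t)) by exact: measurable_fun_pair.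
pose VZ : {mfun T >-> (U1 * U2)%type} :=
  HB.pack (fun t => (V t, Z t)) (isMeasurableFun.Build _ _ _ _ _ mVZ).
pose E' := E `&` (A `*` setT).
have mE' : measurable E' by apply: measurableI => //; exact: measurableX.
have r0 v : A v -> (0 <= r)%E by move=> /sect; exact: le_trans.
have -> : [set t | A (V t) /\ E (V t, Z t)] = VZ @^-1` E'.
  by apply/seteqP; split=> t /=; rewrite /E' /=; tauto.
have prodE := @product_measure_unique _ _ _ _ R (distribution P V) (distribution P Z)
   (distribution P VZ).
rewrite -[P _]/(distribution P VZ E') -prodE//.
rewrite /product_measure1.
apply: (@le_trans _ _ (\int[distribution P V]_(v in A) r)%E).
  rewrite [leRHS]integral_mkcond.
  apply: ge0_le_integral => //.
  - exact: measurable_fun_xsection.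
  - by apply/measurable_restrict => //; rewrite setTI.
  - move=> v _; rewrite /= patchE; case: ifPn => [/set_mem Av|/negP nA].
      apply: le_trans (sect _ Av); apply: le_measure; rewrite ?inE.
      + exact: measurable_xsection.
      + exact: measurable_xsection.
      + by move=> t; rewrite /= !xsectionE => -[].
    rewrite (_ : xsection E' v = set0) ?measure0//.
    by apply/seteqP; split=> // z; rewrite xsectionE => -[_ []] /mem_set.
by rewrite integral_cst.
Qed.

(** Boxes are stable under intersection and generate the product sigma-algebra:
    the input of Dynkin's theorem below. *)
Lemma measurable_boxes (disp : measure_display) (U : measurableType disp) (n : nat) :
  @measurable _ (n.-tuple U) = <<s [set A | exists2 B : 'I_n -> set U,
     (forall i, measurable (B i)) & A = [set v | forall i, B i (tnth v i)]] >>.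
Proof.
apply/seteqP; split.
  apply: smallest_sub; first exact: smallest_sigma_algebra.
  move=> A; rewrite -bigcup_seq => -[i _ [C mC <-]].
  apply: sub_sigma_algebra; exists (fun j => if j == i then C else setT).
    by move=> j; case: ifP.
  apply/seteqP; split=> v /=; first by move=> [_ vC] j; case: eqP => [->|].
  by move=> /(_ i); rewrite eqxx.
apply: smallest_sub; first exact: sigma_algebra_measurable.
move=> A [B mB ->].
rewrite (_ : [set _ | _] = \bigcap_(i in [set: 'I_n]) ((fun v => tnth v i) @^-1` B i)).
  apply: fin_bigcap_measurable => // i _.
  by rewrite -[X in measurable X]setTI; apply: measurable_tnth.
by apply/seteqP; split=> v /= h i; [move=> _|]; exact: h.
Qed.

(** The [k]-th variable is independent of the tuple of all the others. Replacing
    the [k]-th entry by a constant, instead of removing it, keeps the index type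
    ['I_n]. By Dynkin's theorem it suffices to check boxes, and for a box the event on
    the tuple is either empty or an intersection over the indices other than [k]. *)
Lemma indep_replace_entry (disp disp' : measure_display) (T : measurableType disp)
    (U : measurableType disp') (R : realType) (P : probability T R) (n : nat)
    (Z : 'I_n -> {mfun T >-> U}) (k : 'I_n) (u : U) (V : {mfun T >-> n.-tuple U}) :
  mutually_independent P (fun i => Z i : T -> U) ->
  (forall t i, tnth (V t) i = if i == k then u else Z i t) ->
  forall A C, measurable A -> measurable C ->
  P (V @^-1` A `&` Z k @^-1` C) = (P (V @^-1` A) * P (Z k @^-1` C))%E.
Proof.
move=> indep VE A C mA mC.
have mZC := measurable_funPTI (Z k) mC.
move: mA; rewrite measurable_boxes => mA.
pose G := (fun A : set (n.-tuple U) => 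
  P (V @^-1` A `&` Z k @^-1` C) = (P (V @^-1` A) * P (Z k @^-1` C))%E).
apply: (@dynkin_induction _ (n.-tuple U) _ G (measurable_boxes U n) _ _ _ _ _ _ mA) => //.
- move=> _ _ [B1 mB1 ->] [B2 mB2 ->]; exists (fun i => B1 i `&` B2 i).
    by move=> i; exact: measurableI.
  apply/seteqP; split=> v /=; first by move=> [h1 h2] i; split.
  by move=> h; split=> i; case: (h i).
- by rewrite /G !preimage_setT setTI probability_setT mul1e.
- move=> _ [B mB ->]; rewrite /G.
  have [Bu|nBu] := pselect (B k u); last first.
    rewrite (_ : V @^-1` _ = set0) ?set0I ?measure0 ?mul0e//.
    by apply/seteqP; split=> t //= /(_ k); rewrite VE eqxx.
  have VBE : V @^-1` [set v | forall i, B i (tnth v i)] =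
      \bigcap_(i in [set` [set~ k]%SET]) (Z i @^-1` B i).
    apply/seteqP; split=> t /= h i.
      by rewrite /= !inE => /negPf ik; have := h i; rewrite VE ik.
    by rewrite VE; case: eqP => [->//|/eqP ik]; apply: h; rewrite /= !inE.
  pose B' i := if i == k then C else B i.
  have mB' i : measurable (B' i) by rewrite /B'; case: ifP.
  have -> : V @^-1` [set v | forall i, B i (tnth v i)] `&` Z k @^-1` C =
      \bigcap_(i in [set` [set: 'I_n]%SET]) (Z i @^-1` B' i).
    rewrite VBE; apply/seteqP; split=> t /=.
      move=> [h hC] i _; rewrite /B' /=; case: eqP => [->//|/eqP ik].
      by apply: h; rewrite /= !inE.
    move=> h; split=> [i|]; last by have := h k; rewrite /B' eqxx; apply; rewrite /= inE.
    by rewrite /= !inE => /negPf ik; have := h i; rewrite /B' ik; apply; rewrite /= inE.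
  rewrite VBE !indep// (bigD1 k) ?inE//= [RHS]muleC; congr (_ * _)%E.
    by rewrite /B' eqxx.
  by apply: eq_big => i; rewrite !inE// => /negPf ik; rewrite /B' ik.
- move=> S mS; rewrite /G => GS.
  have mVS := measurable_funPTI V mS.
  rewrite preimage_setC probability_setC//.
  rewrite (setIC (~` _)) -setDE measureD//; last by rewrite ltey_eq fin_num_measure.
  rewrite (setIC (Z k @^-1` C)) [X in (_ - X)%E]GS muleBl ?fin_num_measure// ?mul1e//.
- move=> F mF tF GF; rewrite /G preimage_bigcup setI_bigcupl.
  have tVF : trivIset setT (fun i => V @^-1` F i).
    by move=> i j _ _ [t [Fi Fj]]; apply: (tF i j I I); exists (V t).
  have mVF i : measurable (V @^-1` F i) by exact: measurable_funPTI.
  have tVFC : trivIset setT (fun i => V @^-1` F i `&` Z k @^-1` C).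
    exact: trivIset_setIr.
  rewrite !measure_bigcup//; last by move=> i _; exact: measurableI.
  have pf : P (Z k @^-1` C) \is a fin_num by exact: fin_num_measure.
  rewrite muleC -(fineK pf) -nneseriesZl//; apply: eq_eseriesr => i _.
  by rewrite fineK// muleC; exact: GF.
Qed.

(** * Covariates in the span of the others *)

Lemma measure_bigsetU_le (disp : measure_display) (T : measurableType disp)
    (R : realType) (mu : {measure set T -> \bar R}) (I : finType) (Q : pred I)
    (A : I -> set T) :
  (forall i, Q i -> measurable (A i)) ->
  (mu (\big[setU/set0]_(i | Q i) A i) <= \sum_(i | Q i) mu (A i))%E.
Proof.
move=> mA.
suff [] : measurable (\big[setU/set0]_(i | Q i) A i) /\
  (mu (\big[setU/set0]_(i | Q i) A i) <= \sum_(i | Q i) mu (A i))%E by [].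
elim/big_rec2: _ => [|i s B Qi [mB IH]]; first by rewrite measure0.
split; first by apply: measurableU => //; exact: mA.
by apply: le_trans (measureU2 _ _ _) _ => //; [exact: mA|exact: leeD2l].
Qed.

(** One variable [Z k], [k] in [K], is peeled off at a time. Given the other
    variables, the span of those with index in [S] is a fixed subspace of dimension
    less than [d], hence lies in a hyperplane, which [Z k] hits with probability at
    most [r]; the membership events of the remaining indices of [K] do not involve
    [Z k]. *)
Lemma spanned_by_event_le (disp : measure_display) (T : measurableType disp)
    (R : realType) (P : probability T R) (n d : nat)
    (Z : 'I_n -> {mfun T >-> d.-tuple R}) (r : R) (S K : {set 'I_n}) :
  mutually_independent P (fun i => Z i : T -> d.-tuple R) ->
  (forall i (w : 'rV[R]_d), w != 0 -> (P [set t | dotv w (Z i t) = 0%R] <= r%:E)%E) ->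
  (#|S| < d)%N -> [disjoint S & K]%bool ->
  (P [set t | forall i, i \in K -> spanned_by S [tuple Z j t | j < n] (Z i t)]
     <= (r ^+ #|K|)%:E)%E.
Proof.
move=> indep Zr Sd.
have [m] := ubnP #|K|; elim: m K => // m IH K Km SK.
have [->|/set0Pn[k kK]] := eqVneq K finset.set0.
  rewrite cards0 expr0 (_ : [set t | _] = setT) ?probability_setT//.
  by apply/seteqP; split=> t // _ i; rewrite finset.in_set0.
have kS : k \notin S by rewrite (disjointFl SK kK).
pose u : d.-tuple R := [tuple 0 | _ < d].
have mV : measurable_fun setT (fun t => [tuple if i == k then u else Z i t | i < n]).
  apply/measurable_fun_tnthP => i.
  rewrite (_ : _ \o _ = fun t => if i == k then u else Z i t).
    by case: (i == k).
  by apply/funext => t; rewrite /= tnth_mktuple.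
pose V : {mfun T >-> n.-tuple (d.-tuple R)} :=
  HB.pack (fun t => [tuple if i == k then u else Z i t | i < n])
          (isMeasurableFun.Build _ _ _ _ _ mV).
have VE t i : tnth (V t) i = if i == k then u else Z i t by rewrite tnth_mktuple.
have VS t z : spanned_by S (V t) z = spanned_by S [tuple Z j t | j < n] z.
  apply: spanned_by_ext => i iS; rewrite VE tnth_mktuple; case: eqP => // ik.
  by rewrite -ik iS in kS.
pose A := [set v : n.-tuple (d.-tuple R) |
  forall i, i \in (K :\ k)%SET -> spanned_by S v (tnth v i)].
pose E := [set vz : n.-tuple (d.-tuple R) * d.-tuple R | spanned_by S vz.1 vz.2].
have mA : measurable A.
  rewrite (_ : A = \bigcap_(i in [set` (K :\ k)%SET]) [set v | spanned_by S v (tnth v i)]).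
    apply: fin_bigcap_measurable => // i _.
    by apply: measurable_spanned_by => //; exact: measurable_tnth.
  by apply/seteqP; split=> v h i iK; exact: h.
have mE : measurable E by apply: measurable_spanned_by.
have AE : V @^-1` A = [set t | forall i, i \in (K :\ k)%SET ->
    spanned_by S [tuple Z j t | j < n] (Z i t)].
  apply/seteqP; split=> t h i iK.
    by have := h i iK; rewrite VS VE; move: iK; rewrite in_setD1 => /andP[/negPf->].
  rewrite VS VE; have := h i iK.
  by move: iK; rewrite in_setD1 => /andP[/negPf->].
have sect v : A v -> (P (Z k @^-1` xsection E v) <= r%:E)%E.
  move=> _; have [w w0 wE] := hyperplane_of_few v Sd.
  apply: le_trans (Zr k w w0); apply: le_measure; rewrite ?inE.
  - exact/measurable_funPTI/measurable_xsection.
  - exact: measurable_dotv_eq0.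
  - by move=> t; rewrite xsectionE => /wE.
have := indep_section_le (indep_replace_entry indep VE) mA mE sect.
rewrite AE => peel.
(* [r] bounds a probability, since there is at least one nonzero vector *)
have r0 : (0 <= r%:E)%E.
  by have [w w0 _] := hyperplane_of_few [tuple u | _ < n] Sd; apply: le_trans (Zr k w w0).
rewrite (_ : [set t | _] = [set t | A (V t) /\ E (V t, Z k t)]).
  apply: le_trans peel _; rewrite (cardsD1 k) kK exprS EFinM.
  apply: lee_wpmul2l => //; apply: IH.
    by move: Km; rewrite (cardsD1 k) kK.
  by apply: disjointWr SK; exact: subD1set.
apply/seteqP; split=> t /=.
  move=> h; split; last by rewrite /E/= VS; exact: h.
  by rewrite -[A _]/((V @^-1` A) t) AE => i; rewrite in_setD1 => /andP[_]; exact: h.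
rewrite -[A _]/((V @^-1` A) t) AE /E/= VS => -[hA hE] i iK.
have [->//|ik] := eqVneq i k.
by apply: hA; rewrite in_setD1 ik.
Qed.

(** * The mass of hyperplanes *)

Lemma has_ubound_rho (disp : measure_display) (T : measurableType disp) (R : realType)
    (P : probability T R) (d : nat) (X : {mfun T >-> d.-tuple R}) :
  ubound [set fine (P [set t | dotv w (X t) = 0]) | w in [set w : 'rV[R]_d | w != 0]] 1.
Proof.
move=> _ [w _ <-]; rewrite -lee_fin fineK ?fin_num_measure//.
- by apply: probability_le1; exact: measurable_dotv_eq0.
- exact: measurable_dotv_eq0.
Qed.

Lemma prob_le_rho (disp : measure_display) (T : measurableType disp) (R : realType)
    (P : probability T R) (d : nat) (X : {mfun T >-> d.-tuple R}) (w : 'rV[R]_d) :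
  w != 0 -> (P [set t | dotv w (X t) = 0%R] <= (rho P X)%:E)%E.
Proof.
move=> w0; rewrite -[leLHS]fineK; last first.
  by apply: fin_num_measure; exact: measurable_dotv_eq0.
rewrite lee_fin; apply: ub_le_sup; last by exists w.
by exists 1; exact: has_ubound_rho.
Qed.

Lemma const_row1_neq0 (R : realType) (d : nat) : (0 < d)%N -> const_mx 1 != 0 :> 'rV[R]_d.
Proof.
case: d => // d _; apply/eqP => /rowP/(_ ord0)/eqP.
by rewrite !mxE oner_eq0.
Qed.

Lemma rho_ge0 (disp : measure_display) (T : measurableType disp) (R : realType)
    (P : probability T R) (d : nat) (X : {mfun T >-> d.-tuple R}) :
  (0 < d)%N -> 0 <= rho P X.
Proof.
move=> d0; rewrite -lee_fin.
exact: le_trans (prob_le_rho P X (const_row1_neq0 R d0)).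
Qed.

(** Where [X] is orthogonal to all the rows of [M] it is orthogonal to [w], so
    this is a union bound over the rows. *)
Lemma nonorthogonal_submx (disp : measure_display) (T : measurableType disp)
    (R : realType) (P : probability T R) (d m : nat) (X : {mfun T >-> d.-tuple R})
    (M : 'M[R]_(m, d)) (w : 'rV[R]_d) (e : R) :
  (w <= M)%MS ->
  (forall i, P [set t | dotv (row i M) (X t) <> 0%R] <= e%:E)%E ->
  (P [set t | dotv w (X t) <> 0%R] <= (m%:R * e)%:E)%E.
Proof.
move=> /submxP[D wE] Me.
have mne (v : 'rV[R]_d) : measurable [set t | dotv v (X t) <> 0].
  by apply: measurableC; exact: measurable_dotv_eq0.
apply: (@le_trans _ _ (\sum_(i < m) P [set t | dotv (row i M) (X t) <> 0%R])%E).
  apply: le_trans (measure_bigsetU_le _ _) => //.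
  apply: le_measure; rewrite ?inE//; first exact: bigsetU_measurable.
  move=> t /= wt; apply: contrapT => nt; apply: wt.
  have Mt i : dotv (row i M) (X t) = 0.
    apply: contrapT => it; apply: nt; rewrite -bigcup_seq.
    by exists i => //=; rewrite mem_index_enum.
  rewrite /dotv wE; under eq_bigr => j _ do rewrite mxE mulr_suml.
  rewrite exchange_big big1//= => i _.
  under eq_bigr => j _ do rewrite -mulrA.
  rewrite -mulr_sumr [X in _ * X](_ : _ = 0) ?mulr0// -[RHS](Mt i).
  by apply: eq_bigr => j _; rewrite mxE.
apply: (@le_trans _ _ (\sum_(i < m) e%:E)%E); first exact: lee_sum.
by rewrite sumEFin lee_fin sumr_const card_ord mulr_natl.
Qed.

(** Were the supremum [1], then for every [e > 0] the set [W e] of vectors that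
    are orthogonal to [X] up to probability [e] would contain a nonzero vector. As [e]
    decreases, the span of [W e] decreases, hence is eventually a constant subspace
    [U], of some dimension [r]. A nonzero vector of [U] is for every small [e] a
    combination of [r] elements of [W e], hence orthogonal to [X] up to probability
    [r * e], that is, almost surely, which nondegeneracy forbids. *)
Lemma rho_lt1 (disp : measure_display) (T : measurableType disp) (R : realType)
    (P : probability T R) (d : nat) (X : {mfun T >-> d.-tuple R}) :
  (0 < d)%N -> nondegenerate P X -> rho P X < 1.
Proof.
move=> d0 nd; rewrite ltNge; apply/negP => rho1.
pose W e := [set w : 'rV[R]_d | P [set t | dotv w (X t) <> 0%R] <= e%:E]%E.
have mN (w : 'rV[R]_d) : measurable [set t | dotv w (X t) = 0].
  exact: measurable_dotv_eq0.
have mNC (w : 'rV[R]_d) : measurable [set t | dotv w (X t) <> 0].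
  exact: (measurableC (mN w)).
have neP (w : 'rV[R]_d) :
    P [set t | dotv w (X t) <> 0] = (1 - P [set t | dotv w (X t) = 0%R])%E.
  by rewrite -probability_setC.
have nzW e : 0 < e -> exists2 w, W e w & w != 0.
  move=> e0.
  have [|_ [w w0 <-] we] := @sup_adherent R
    [set fine (P [set t | dotv w (X t) = 0]) | w in [set w : 'rV[R]_d | w != 0]] e e0.
    split; last by exists 1; exact: has_ubound_rho.
    by eexists; exists (const_mx 1) => //=; exact: const_row1_neq0.
  exists w => //; rewrite /W /= neP -(@fineK _ (P _)) ?fin_num_measure//.
  by rewrite -EFinD lee_fin; rewrite -/(rho P X) in we; lra.
have subW e e' : e <= e' -> W e `<=` W e'.
  by move=> ee' w /le_trans; apply; rewrite lee_fin.
(* [U] is taken of least rank among the subspaces containing some [W e] *)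
pose covers r := exists e (U : 'M[R]_d),
  [/\ 0 < e, \rank U = r & forall w, W e w -> (w <= U)%MS].
have exr : exists r, `[< covers r >].
  exists d; apply/asboolP; exists 1, 1%:M.
  by split=> // [|w _]; [rewrite mxrank1|rewrite submx1].
have [r /asboolP[e0 [U [e0_gt0 Ur WU]]] rmin] := find_ex_minn exr.
(* by minimality, fewer than [r] vectors never span a subspace containing [W e],
   so a free family in [W e] can be extended until it has [r] elements *)
have span_U e : 0 < e -> e <= e0 -> forall k, (k <= r)%N ->
    exists M : 'M[R]_(k, d), \rank M = k /\ forall i, W e (row i M).
  move=> e_gt0 ee0; elim=> [_|k IH kr].
    by exists 0; split=> [|[]//]; rewrite mxrank0.
  have [M [Mk MW]] := IH (ltnW kr).
  have [w Ww wM] : exists2 w, W e w & ~~ (w <= M)%MS.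
    apply: contrapT => nW; have : (r <= k)%N; last by rewrite leqNgt kr.
    apply: rmin; apply/asboolP; exists e, << M >>%MS; split=> //.
      by rewrite mxrank_gen.
    move=> w Ww; rewrite genmxE; apply: contrapT => /negP wM.
    by apply: nW; exists w.
  have rank_wM : \rank (col_mx w M) = k.+1.
    have wMI : (w :&: M)%MS = 0.
      apply/eqP; rewrite -mxrank_eq0 -leqn0 -ltnS.
      rewrite ltnNge; apply: contra wM => h; apply: submx_trans (capmxSr w M).
      rewrite -(geq_leqif (mxrank_leqif_sup (capmxSl w M))).
      exact: leq_trans (rank_leq_row _) h.
    rewrite -addsmxE mxrank_disjoint_sum// Mk rank_rV.
    by case: eqP => // w0; rewrite w0 sub0mx in wM.
  have row_wM (i : 'I_(1 + k)) : W e (row i (col_mx w M)).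
    case: (split_ordP i) => j ->; first by rewrite rowKu (ord1 j) row_id.
    by rewrite rowKd.
  by exists (col_mx w M).
have [w0 Ww0 w0_neq0] := nzW e0 e0_gt0.
have w0U := WU _ Ww0.
have small e : 0 < e -> e <= e0 -> (P [set t | dotv w0 (X t) <> 0%R] <= (r%:R * e)%:E)%E.
  move=> e_gt0 ee0; have [M [Mr MW]] := span_U e e_gt0 ee0 r (leqnn r).
  apply: (@nonorthogonal_submx _ _ _ _ _ _ _ M) => //; apply: submx_trans w0U _.
  have MU : (M <= U)%MS by apply/row_subP => i; exact: WU (subW _ _ ee0 _ (MW i)).
  by rewrite -(geq_leqif (mxrank_leqif_sup MU)) Ur Mr.
suff : P [set t | dotv w0 (X t) <> 0] = 0%E.
  move=> h; move: w0_neq0; rewrite (nd w0) ?eqxx//.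
  have := neP w0; rewrite h -(@fineK _ (P [set t | _ = _])) ?fin_num_measure//.
  by rewrite -EFinD => -[q]; congr EFin; lra.
have pf : P [set t | dotv w0 (X t) <> 0] \is a fin_num.
  exact: fin_num_measure.
apply/eqP; rewrite eq_le measure_ge0 andbT -(fineK pf) lee_fin.
rewrite leNgt; apply/negP; set s := fine _ => s0.
(* any [e] with [r * e < s] contradicts [small] *)
pose e := Num.min e0 (s / (2 * (r%:R + 1))).
have r1 : 0 < 2 * (r%:R + 1) :> R by rewrite mulr_gt0// ltr_wpDl.
have := small e; rewrite -(fineK pf) -/s lee_fin => /(_ _ _)/=.
have e_gt0 : 0 < e by rewrite lt_min e0_gt0 divr_gt0.
have e_le : e <= s / (2 * (r%:R + 1)) by rewrite ge_min lexx orbT.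
move=> /(_ e_gt0); rewrite ge_min lexx => /(_ isT).
rewrite leNgt => /negP; apply.
have : r%:R * e <= r%:R * (s / (2 * (r%:R + 1))) by rewrite ler_wpM2l.
move/le_lt_trans; apply; rewrite mulrA ltr_pdivrMr//.
have : 0 <= r%:R * s by rewrite mulr_ge0// ltW.
by nra.
Qed.

(** * Recovery by empirical risk minimization *)

Lemma iid_copies_comp (disp d1 d2 : measure_display) (T : measurableType disp)
    (U1 : measurableType d1) (U2 : measurableType d2) (R : realType)
    (P : probability T R) (n : nat) (Z0 : T -> U1) (Z : 'I_n -> T -> U1) (f : U1 -> U2) :
  measurable_fun setT f -> iid_copies P Z0 Z ->
  iid_copies P (f \o Z0) (fun i => f \o Z i).
Proof.
move=> mf [idd indep].
have mfB B : measurable B -> measurable (f @^-1` B).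
  by move=> mB; rewrite -[X in measurable X]setTI; exact: mf.
split=> [i B mB|J B mB]; first exact: (idd i _ (mfB _ mB)).
exact: (indep J (fun i => f @^-1` B i) (fun i => mfB _ (mB i))).
Qed.

Lemma measurable_misfit (disp : measure_display) (T : measurableType disp) (R : realType)
    (d : nat) (w : 'rV[R]_d) (f : T -> d.-tuple R) (g : T -> R) :
  measurable_fun setT f -> measurable_fun setT g ->
  measurable [set t | g t <> dotv w (f t)].
Proof.
move=> mf mg; rewrite (_ : [set t | _] = ~` [set t | g t - dotv w (f t) = 0]).
  apply: measurableC; rewrite -[X in measurable X]setTI.
  have mfg := measurable_funB mg (measurable_dotv w mf).
  exact: (mfg measurableT [set 0] (measurable_set1 0)).
apply/seteqP; split=> t /= h; first by move=> /subr0_eq.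
by move=> e; apply: h; rewrite e subrr.
Qed.

Lemma prob_copy_misfit (disp : measure_display) (T : measurableType disp) (R : realType)
    (P : probability T R) (d n : nat) (X : {mfun T >-> d.-tuple R}) (Y : {mfun T >-> R})
    (Xs : 'I_n -> {mfun T >-> d.-tuple R}) (Ys : 'I_n -> {mfun T >-> R}) (w : 'rV[R]_d) :
  iid_copies P (fun t => (X t, Y t)) (fun i t => (Xs i t, Ys i t)) ->
  {ae P, forall t, Y t = dotv w (X t)} ->
  forall i, measurable [set t | Ys i t <> dotv w (Xs i t)] /\
    P [set t | Ys i t <> dotv w (Xs i t)] = 0%E.
Proof.
move=> [idd _] YX i.
split; first exact: measurable_misfit.
pose B := [set u : d.-tuple R * R | u.2 <> dotv w u.1].
have mB : measurable B by exact: measurable_misfit.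
have := idd i B mB; rewrite [X in _ = X](_ : _ = 0%E)//.
by apply: measure_negligible => //; exact: measurable_misfit.
Qed.

(** Outside a null set, [what <> wstar] means that the nonzero vector
    [what - wstar] is orthogonal to all the [Xs i], so by [few_span] some [S] of size
    [d.-1] spans them all. For a fixed [S], the [n - d + 1] variables outside [S] lie
    in the span of those inside with probability at most [rho ^ (n - d + 1)]. *)
Lemma prob_erm_neq_le (disp : measure_display) (T : measurableType disp) (R : realType)
    (P : probability T R) (d n : nat) (X : {mfun T >-> d.-tuple R}) (Y : {mfun T >-> R})
    (Xs : 'I_n -> {mfun T >-> d.-tuple R}) (Ys : 'I_n -> {mfun T >-> R})
    (wstar : 'rV[R]_d) (p : R) (what : T -> 'rV[R]_d) :
  (0 < d)%N -> (d <= n)%N -> 1 < p ->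
  iid_copies P (fun t => (X t, Y t)) (fun i t => (Xs i t, Ys i t)) ->
  {ae P, forall t, Y t = dotv wstar (X t)} ->
  (forall t, is_erm p (fun i => Xs i t) (fun i => Ys i t) (what t)) ->
  measurable [set t | what t <> wstar] ->
  (P [set t | what t <> wstar] <= ('C(n, d.-1)%:R * rho P X ^+ (n - d).+1)%:E)%E.
Proof.
move=> d0 dn p1 iid YX erm mwhat.
have misfit := prob_copy_misfit iid YX.
have [iddX indepX] : iid_copies P (X : T -> _) (fun i => Xs i : T -> _).
  exact: (iid_copies_comp measurable_fst iid).
pose x t := [tuple Xs i t | i < n].
pose E (S : {set 'I_n}) := [set t | forall i, i \in (~: S)%SET -> spanned_by S (x t) (Xs i t)].
have mE S : measurable (E S).
  rewrite (_ : E S = \bigcap_(i in [set` (~: S)%SET]) [set t | spanned_by S (x t) (Xs i t)]).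
    apply: fin_bigcap_measurable => // i _.
    apply: measurable_spanned_by => //; apply/measurable_fun_tnthP => j.
    rewrite (_ : _ \o _ = Xs j)//.
    by apply/funext => t; rewrite /= tnth_mktuple.
  by apply/seteqP; split=> v h i iK; exact: h.
have PE (S : {set 'I_n}) : #|S| == d.-1 -> (P (E S) <= (rho P X ^+ (n - d).+1)%:E)%E.
  move=> /eqP Sd.
  have -> : ((n - d).+1 = #|~: S|)%N.
    by rewrite cardsCs finset.setCK Sd card_ord -subSn// -[X in (_ - X)%N](prednK d0) subSS.
  apply: spanned_by_event_le => //.
  - move=> i w w0; rewrite -[X in P X]/(Xs i @^-1` [set z | dotv w z = 0]) iddX.
      exact: prob_le_rho.
    exact: measurable_dotv_eq0.
  - by rewrite Sd prednK.
  - by rewrite -setI_eq0 finset.setICr.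
pose N := \big[setU/set0]_(i < n) [set t | Ys i t <> dotv wstar (Xs i t)].
have mN : measurable N by apply: bigsetU_measurable => i _; case: (misfit i).
have PN : P N = 0%E.
  apply/eqP; rewrite eq_le measure_ge0 andbT.
  apply: le_trans (measure_bigsetU_le _ _) _; first by move=> i _; case: (misfit i).
  by rewrite big1// => i _; case: (misfit i).
pose EU := \big[setU/set0]_(S : {set 'I_n} | #|S| == d.-1) E S.
have mEU : measurable EU by exact: bigsetU_measurable.
apply: (@le_trans _ _ (P (N `|` EU))).
  apply: le_measure; rewrite ?inE//; first exact: measurableU.
  move=> t wt; have [Nt|nNt] := pselect (N t); [by left|right].
  have yE i : Ys i t = dotv wstar (Xs i t).
    apply: contrapT => h; apply: nNt; rewrite /N -bigcup_seq.
    by exists i => //=; rewrite mem_index_enum.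
  have interp := erm_interpolates p1 yE (erm t).
  have w0 : what t - wstar != 0 by rewrite subr_eq0; apply/eqP.
  have [i|S Sd xS] := few_span (x := x t) dn w0.
    rewrite tnth_mktuple -[RHS](subrr (Ys i t)) -{1}interp yE /dotv -sumrB.
    by apply: eq_bigr => j _; rewrite !mxE mulrBl.
  rewrite /EU (bigD1 S) ?Sd//=; left => i _.
  by have := xS i; rewrite tnth_mktuple.
apply: le_trans (measureU2 _ _ _) _ => //.
rewrite [X in (X + _)%E]PN add0e.
apply: le_trans (measure_bigsetU_le _ _) _ => //.
apply: (@le_trans _ _ (\sum_(S : {set 'I_n} | #|S| == d.-1) (rho P X ^+ (n - d).+1)%:E)%E).
  exact: lee_sum.
by rewrite sumEFin lee_fin sumr_const -[leLHS]mulr_natl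
  -[in leRHS](card_ord n) -card_draws cardsE card_ord.
Qed.

Theorem theorem3 (R : realType) :
  exists2 C : R, 0 < C &
  forall (disp : measure_display) (T : measurableType disp)
    (P : probability T R) (d n : nat)
    (X : {RV P >-> d.-tuple R}) (Y : {RV P >-> R})
    (Xs : 'I_n -> {RV P >-> d.-tuple R}) (Ys : 'I_n -> {RV P >-> R})
    (wstar : 'rV[R]_d),
  (0 < d)%N ->
  nondegenerate P X ->
  iid_copies P (fun t => (X t, Y t)) (fun i t => (Xs i t, Ys i t)) ->
  {ae P, forall t, Y t = dotv wstar (X t)} ->
  [/\ rho P X < 1,
      (d <= n)%N ->
      forall (p : R), 1 < p ->
      forall what : T -> 'rV[R]_d,
      (forall t, is_erm p (fun i => Xs i t) (fun i => Ys i t) (what t)) ->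
      measurable [set t | what t <> wstar] ->
      (P [set t | what t <> wstar] <=
         ('C(n, d.-1)%:R * rho P X ^+ (n - d).+1)%:E)%E
    & forall delta : R, 0 < delta -> delta <= 1 ->
      sample_size C d (rho P X) delta <= n%:R ->
      forall (p : R), 1 < p ->
      forall what : T -> 'rV[R]_d,
      (forall t, is_erm p (fun i => Xs i t) (fun i => Ys i t) (what t)) ->
      measurable [set t | what t = wstar] ->
      ((1 - delta)%:E <= P [set t | what t = wstar])%E].
Proof.
exists 10 => // disp T P d n X Y Xs Ys wstar d0 nd iid YX.
have rho1 := rho_lt1 d0 nd.
split=> //; first by move=> dn p p1 what; exact: prob_erm_neq_le iid YX.
move=> delta del0 del1 size_n p p1 what erm mwhat.
have [dn tail] := sample_size_suffices d0 (rho_ge0 P X d0) rho1 del0 del1 size_n.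
have mneq : measurable [set t | what t <> wstar] := measurableC mwhat.
have fail := prob_erm_neq_le d0 dn p1 iid YX erm mneq.
have PE : P [set t | what t <> wstar] = (1 - P [set t | what t = wstar])%E.
  by rewrite -probability_setC.
move: fail; rewrite PE -(@fineK _ (P [set t | _ = _])) ?fin_num_measure//.
by rewrite -EFinD !lee_fin; lra.
Qed.
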